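(* Let $A\in\mathbb{C}^{m\times n}$ and let $X_1,X_2\in\mathbb{C}^{n\times m}$ be such that $X_1\in A\{2\}$ and $X_2\in A\{1\}$. Then $A^{(E,F)}=X_2AX_1$, where $E=X_2AX_1A$ and $F=AX_1$.
   Context: $A\{1\}$ is the set of inner inverses of $A$ (matrices $Y\in\mathbb{C}^{n\times m}$ with $AYA=A$) and $A\{2\}$ is the set of outer inverses of $A$ (matrices $Y\in\mathbb{C}^{n\times m}$ with $YAY=Y$). $EF$-inverse: for $A\in\mathbb{C}^{m\times n}$, $E\in\mathbb{C}^{n\times n}$, $F\in\mathbb{C}^{m\times m}$, an $EF$-inverse of $A$ is a matrix $X\in\mathbb{C}^{n\times m}$ with $XAX=X$, $XA=E$ and $AX=F$. When it exists it is unique and is denoted $A^{(E,F)}$. The asserted equality includes the existence of $A^{(E,F)}$. (The matrix $X_2AX_1$ is called a generalized bilateral inverse of $A$.) *)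

(* Defs.v *)
From mathcomp Require Import all_boot all_order all_algebra.
From mathcomp Require Import complex.
From mathcomp Require Import boolp classical_sets reals.
Set Implicit Arguments.
Unset Strict Implicit.
Unset Printing Implicit Defensive.
Import GRing.Theory.
Local Open Scope classical_set_scope.
Local Open Scope ring_scope.

Section GeneralizedInverses.
Variables (R : realType) (m n : nat).
Local Notation C := R[i].
Implicit Types (A : 'M[C]_(m, n)) (E : 'M[C]_n) (F : 'M[C]_m).
Implicit Types X Y : 'M[C]_(n, m).

Definition inner_inverses A : set 'M[C]_(n, m) := [set Y | A *m Y *m A = A].

Definition outer_inverses A : set 'M[C]_(n, m) := [set Y | Y *m A *m Y = Y].

Definition is_EF_inverse A E F X : Prop :=
  [/\ X *m A *m X = X, X *m A = E & A *m X = F].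

Lemma is_EF_inverse_unique A E F X Y :
  is_EF_inverse A E F X -> is_EF_inverse A E F Y -> X = Y.
Proof.
move=> [XAX XA AX] [YAY YA AY].
by rewrite -XAX XA -YA -mulmxA AX -AY mulmxA YAY.
Qed.

(* The value 0 when no EF-inverse exists is a dummy: a claim about
   [EF_inverse A E F] only has content together with existence. *)
Definition EF_inverse A E F : 'M[C]_(n, m) :=
  xget 0 [set X | is_EF_inverse A E F X].

End GeneralizedInverses.

(* Main.v *)
Require Import Defs.
From mathcomp Require Import all_boot all_order all_algebra.
From mathcomp Require Import complex.
From mathcomp Require Import boolp classical_sets reals.
Local Open Scope classical_set_scope.
Local Open Scope ring_scope.

(** The inner inverse [X2] cancels in [A *m X2 *m A = A], which turns
    [A *m (X2 *m A *m X1)] into [A *m X1].  Idempotence of the candidate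
    [X2 *m A *m X1] under [A] then reduces to [X1 *m A *m X1 = X1], the outer
    equation of [X1].  An EF-inverse is determined by its defining equations,
    so the candidate is the value chosen by [EF_inverse]. *)

Lemma EF_inverse_eq (R : realType) (m n : nat) (A : 'M[R[i]]_(m, n))
    (E : 'M[R[i]]_n) (F : 'M[R[i]]_m) (X : 'M[R[i]]_(n, m)) :
  is_EF_inverse A E F X -> EF_inverse A E F = X.
Proof.
move=> hX; apply: xget_unique => // Y hY.
exact: is_EF_inverse_unique hY hX.
Qed.

Lemma bilateral_is_EF_inverse (R : realType) (m n : nat)
    (A : 'M[R[i]]_(m, n)) (X1 X2 : 'M[R[i]]_(n, m)) :
  X1 *m A *m X1 = X1 -> A *m X2 *m A = A ->
  is_EF_inverse A (X2 *m A *m X1 *m A) (A *m X1) (X2 *m A *m X1).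
Proof.
move=> outer1 inner2.
have AX : A *m (X2 *m A *m X1) = A *m X1 by rewrite !mulmxA inner2.
split=> //.
by rewrite -mulmxA AX -!mulmxA (mulmxA X1) outer1.
Qed.

Theorem theorem4p4 (R : realType) (m n : nat)
    (A : 'M[R[i]]_(m, n)) (X1 X2 : 'M[R[i]]_(n, m))
    (hX1 : X1 \in outer_inverses A) (hX2 : X2 \in inner_inverses A) :
  let E : 'M[R[i]]_n := X2 *m A *m X1 *m A in
  let F : 'M[R[i]]_m := A *m X1 in
  (exists X : 'M[R[i]]_(n, m), is_EF_inverse A E F X) /\
  EF_inverse A E F = X2 *m A *m X1.
Proof.
move: hX1 hX2; rewrite !inE => outer1 inner2 E F.
have hX : is_EF_inverse A E F (X2 *m A *m X1).
  exact: bilateral_is_EF_inverse.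
by split; [exists (X2 *m A *m X1) | exact: EF_inverse_eq].
Qed.
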